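(* Let $A\in\mathcal{M}_d(\mathbb{C})$ be self-adjoint, let $\mathcal{X},\mathcal{Y}\subset\mathbb{C}^d$ be subspaces with $\dim(\mathcal{X})=\dim(\mathcal{Y})=k$, and let $X,Y\in\mathcal{M}_{d,k}(\mathbb{C})$ have columns forming orthonormal bases of $\mathcal{X}$ and $\mathcal{Y}$, respectively. If $\Theta_1(\mathcal{X},\mathcal{Y})<\frac{\pi}{2}$, then $$|\lambda(\rho(X))-\lambda(\rho(Y))|\prec_w \frac{2\,\mathrm{Spr}(A,\mathcal{X}+\mathcal{Y})\,\sin(\Theta(\mathcal{X},\mathcal{Y}))}{\cos(\Theta(\mathcal{X},\mathcal{Y}))}.$$
   Context: $\mathcal{M}_{d,k}(\mathbb{C})$ is the space of complex $d\times k$ matrices and $\mathcal{M}_d(\mathbb{C})=\mathcal{M}_{d,d}(\mathbb{C})$. Set $\rho(X)=X^*AX$, $\rho(Y)=Y^*AY$. For a self-adjoint matrix or operator $C$, $\lambda(C)$ is the vector of eigenvalues counted with multiplicity in non-increasing order. For a subspace $\mathcal{Z}\subset\mathbb{C}^d$ with $\dim\mathcal{Z}=p$, let $A_{\mathcal{Z}}=P_{\mathcal{Z}}A|_{\mathcal{Z}}$ be the compression of $A$ to $\mathcal{Z}$ (a self-adjoint operator on $\mathcal{Z}$; $P_{\mathcal{Z}}$ is the orthogonal projection onto $\mathcal{Z}$), and let the spectral spread of $A$ relative to $\mathcal{Z}$ be $\mathrm{Spr}(A,\mathcal{Z})=(\lambda_i(A_{\mathcal{Z}})-\lambda_{p-i+1}(A_{\mathcal{Z}}))_{i=1}^p\in\mathbb{R}^p$.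 With $p=\dim(\mathcal{X}+\mathcal{Y})$ (so $k\le p\le 2k$), $\mathrm{Spr}(A,\mathcal{X}+\mathcal{Y})\sin(\Theta(\mathcal{X},\mathcal{Y}))$ denotes the vector in $\mathbb{R}^k$ with entries $(\lambda_i(A_{\mathcal{X}+\mathcal{Y}})-\lambda_{p-i+1}(A_{\mathcal{X}+\mathcal{Y}}))\sin(\Theta_i(\mathcal{X},\mathcal{Y}))$, $1\le i\le k$. The principal angles $\Theta(\mathcal{X},\mathcal{Y})=(\Theta_i(\mathcal{X},\mathcal{Y}))_{i=1}^k$, with $\pi/2\ge\Theta_1\ge\dots\ge\Theta_k\ge0$, are defined by $\cos(\Theta_{k-i+1}(\mathcal{X},\mathcal{Y}))=s_i(X^*Y)$, where $s_1\ge\dots\ge s_k$ are singular values. Operations on vectors are entrywise. For $x,y\in\mathbb{R}^k$, $x\prec_w y$ (submajorization) means $\sum_{i=1}^j x_i^\downarrow\le\sum_{i=1}^j y_i^\downarrow$ for every $1\le j\le k$, where $x^\downarrow$ is $x$ rearranged in non-increasing order. *)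

(* Defs.v *)
From HB Require Import structures.
From mathcomp Require Import all_boot all_order all_algebra.
From mathcomp Require Import complex.
From mathcomp Require Import reals trigo.

Set Implicit Arguments.
Unset Strict Implicit.
Unset Printing Implicit Defensive.

Import Order.TTheory GRing.Theory Num.Theory.

Local Open Scope ring_scope.
Local Open Scope complex_scope.
Local Open Scope sesquilinear_scope.

Section Defs.
Variable R : realType.
Local Notation C := R[i].

(* [closed_field_poly_normal] lists the roots of the characteristic polynomial
   with multiplicity.  For a self-adjoint matrix they are all real, so that
   taking real parts loses nothing. *)
Definition eigvals (n : nat) (M : 'M[C]_n) : n.-tuple R :=
  [tuple (sort >=%R
    [seq complex.Re z | z <- sval (closed_field_poly_normal (char_poly M))])`_i | i < n].

(* [mxof] acts on row vectors: it is the transpose of the usual matrix of [f],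
   with the same characteristic polynomial. *)
Definition lfun_eigvals (V : vectType C) (f : 'End(V)) :
    (\dim {:V}).-tuple R :=
  eigvals (passmx.mxof (vbasis fullv) (vbasis fullv) f).

Definition singvals (m n : nat) (M : 'M[C]_(m, n)) : n.-tuple R :=
  [tuple Num.sqrt (tnth (eigvals (M^t* *m M)) i) | i < n].

Definition orthonormal_basis (d k : nat) (V : {vspace 'cV[C]_d})
    (X : 'M[C]_(d, k)) : Prop :=
  X^t* *m X = 1%:M /\ basis_of V [seq col j X | j <- enum 'I_k].

(* [proj_ortho] works with row vectors and row spaces, hence the transposes. *)
Definition orthoproj (d : nat) (Z : {vspace 'cV[C]_d}) : 'M[C]_d :=
  (proj_ortho (\matrix_(i < \dim Z) (tnth (vbasis Z) i)^T))^T.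

(* [vsproj Z] only recasts the vector [P_Z A u] of [Z] in the type
   [subvs_of Z]. *)
Definition compression (d : nat) (A : 'M[C]_d) (Z : {vspace 'cV[C]_d}) :
    'End(subvs_of Z) :=
  linfun (fun u : subvs_of Z => vsproj Z (orthoproj Z *m (A *m vsval u))).

(* [lam] has [\dim {:subvs_of Z}] entries, which equals [\dim Z] only
   propositionally ([dimvf]), hence the use of [nth] instead of [tnth]. *)
Definition spectral_spread (d : nat) (A : 'M[C]_d) (Z : {vspace 'cV[C]_d}) :
    (\dim Z).-tuple R :=
  let lam := lfun_eigvals (compression A Z) in
  [tuple lam`_i - lam`_(rev_ord i) | i < \dim Z].

(* The principal angles between the column spaces of [X] and [Y], whose columns
   are orthonormal, in non-increasing order. *)
Definition principal_angles (d k : nat) (X Y : 'M[C]_(d, k)) : k.-tuple R :=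
  [tuple acos (tnth (singvals (X^t* *m Y)) (rev_ord i)) | i < k].

Definition submajorized (k : nat) (x y : k.-tuple R) : Prop :=
  forall j : nat, (1 <= j <= k)%N ->
    \sum_(i < j) (sort >=%R x)`_i <= \sum_(i < j) (sort >=%R y)`_i.

End Defs.

(* Main.v *)
Require Import Defs.
From HB Require Import structures.
From mathcomp Require Import all_boot all_order all_algebra.
From mathcomp Require Import perm complex zify ring lra.
From mathcomp Require Import reals trigo.

Set Implicit Arguments.
Unset Strict Implicit.
Unset Printing Implicit Defensive.

Import Order.TTheory GRing.Theory Num.Theory.

Local Open Scope ring_scope.
Local Open Scope complex_scope.
Local Open Scope sesquilinear_scope.

(* After unitary changes of the bases, X^* Y = diag (cos Theta_i).  By
   polarization X^* A X - Y^* A Y is the Hermitian part of G^* A F, where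
   F = X + Y and G = X - Y have orthogonal column spaces, F^* F <= 4 and
   G^* G = diag (4 s_i^2) with s_i = sin (Theta_i / 2).  The Lidskii-Mirsky
   theorem bounds the sum of the j largest |lambda_i (X^* A X) -
   lambda_i (Y^* A Y)| by the real part of a trace tr (U2^* G^* A F U1) with
   isometries U1 and U2.  Abel summation over the half-angle sines s_i reduces
   that trace to terms tr (b^* A a), where a and b are contractions with
   orthogonal ranges and tr (a^* a), tr (b^* b) <= m; by Ky Fan's variational
   principle the real part of such a term is at most half the sum of the first
   m entries of the spectral spread.  The outcome is the bound 2 Spr_i s_i, which is
   stronger than the stated one since sin (t / 2) <= tan t. *)

(** * The real inner product Re tr (A^* B) *)

Section InnerProduct.
Variable R : realType.
Local Notation C := R[i].

Lemma cReD (x y : C) : complex.Re (x + y) = complex.Re x + complex.Re y.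
Proof. by case: x => ? ?; case: y. Qed.

Lemma cReN (x : C) : complex.Re (- x) = - complex.Re x.
Proof. by case: x. Qed.

Lemma cReZ (a : R) (x : C) : complex.Re (a%:C * x) = a * complex.Re x.
Proof. by case: x => u v /=; rewrite mul0r subr0. Qed.

Lemma cRe_sum (I : Type) (r : seq I) (P : pred I) (F : I -> C) :
  complex.Re (\sum_(i <- r | P i) F i) = \sum_(i <- r | P i) complex.Re (F i).
Proof. by elim/big_rec2: _ => //= i y x _ <-; rewrite cReD. Qed.

Lemma cRe_conj (x : C) : complex.Re (Num.conj x) = complex.Re x.
Proof. by case: x. Qed.

Lemma conj_real (a : R) : Num.conj (a%:C : C) = a%:C.
Proof. exact: conjc_real. Qed.

Lemma adjmxM m n p (A : 'M[C]_(m, n)) (B : 'M[C]_(n, p)) :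
  (A *m B)^t* = B^t* *m A^t*.
Proof. by rewrite trmx_mul map_mxM. Qed.

Lemma adjmxD m n (A B : 'M[C]_(m, n)) : (A + B)^t* = A^t* + B^t*.
Proof. by rewrite linearD map_mxD. Qed.

Lemma adjmxN m n (A : 'M[C]_(m, n)) : (- A)^t* = - A^t*.
Proof. by rewrite linearN map_mxN. Qed.

Lemma adjmxZ m n (a : R) (A : 'M[C]_(m, n)) : (a%:C *: A)^t* = a%:C *: A^t*.
Proof. by apply/matrixP => i j; rewrite !mxE rmorphM; congr (_ * _); exact: conj_real. Qed.

Lemma adjmx1 n : (1%:M : 'M[C]_n)^t* = 1%:M.
Proof. by rewrite trmx1 map_mx1. Qed.

(** The real part of the Frobenius inner product: being symmetric and real-valued, it leaves later
    estimates to ordinary real arithmetic. *)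
Definition ip m n (A B : 'M[C]_(m, n)) : R := complex.Re (\tr (A^t* *m B)).

Lemma ipE m n (A B : 'M[C]_(m, n)) :
  ip A B = \sum_i \sum_j complex.Re (Num.conj (A i j) * B i j).
Proof.
rewrite /ip /mxtrace cRe_sum exchange_big; apply: eq_bigr => j _ /=.
by rewrite mxE cRe_sum; apply: eq_bigr => i _; rewrite !mxE.
Qed.

Lemma ipC m n (A B : 'M[C]_(m, n)) : ip A B = ip B A.
Proof.
rewrite !ipE; apply: eq_bigr => i _; apply: eq_bigr => j _.
by rewrite -cRe_conj rmorphM /= conjCK mulrC.
Qed.

Lemma ipDr m n (A B D : 'M[C]_(m, n)) : ip A (B + D) = ip A B + ip A D.
Proof. by rewrite /ip mulmxDr mxtraceD cReD. Qed.

Lemma ipNr m n (A B : 'M[C]_(m, n)) : ip A (- B) = - ip A B.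
Proof. by rewrite /ip mulmxN linearN cReN. Qed.

Lemma ipZr m n (a : R) (A B : 'M[C]_(m, n)) : ip A (a%:C *: B) = a * ip A B.
Proof. by rewrite /ip -scalemxAr mxtraceZ cReZ. Qed.

Lemma ipDl m n (A B D : 'M[C]_(m, n)) : ip (B + D) A = ip B A + ip D A.
Proof. by rewrite !(ipC _ A) ipDr. Qed.

Lemma ipNl m n (A B : 'M[C]_(m, n)) : ip (- B) A = - ip B A.
Proof. by rewrite !(ipC _ A) ipNr. Qed.

Lemma ipZl m n (a : R) (A B : 'M[C]_(m, n)) : ip (a%:C *: B) A = a * ip B A.
Proof. by rewrite !(ipC _ A) ipZr. Qed.

Lemma ip0l m n (A : 'M[C]_(m, n)) : ip 0 A = 0.
Proof. by rewrite /ip trmx0 map_mx0 mul0mx mxtrace0. Qed.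

Lemma ip_sumr (I : Type) (r : seq I) m n (A : 'M[C]_(m, n)) (B : I -> 'M[C]_(m, n)) :
  ip A (\sum_(i <- r) B i) = \sum_(i <- r) ip A (B i).
Proof.
by elim/big_rec2: _ => [|i y x _ <-]; [rewrite ipC ip0l | rewrite ipDr].
Qed.

Lemma ip_suml (I : Type) (r : seq I) m n (A : 'M[C]_(m, n)) (B : I -> 'M[C]_(m, n)) :
  ip (\sum_(i <- r) B i) A = \sum_(i <- r) ip (B i) A.
Proof. by rewrite ipC ip_sumr; apply: eq_bigr => i _; rewrite ipC. Qed.

Lemma ipMl m n p (A : 'M[C]_(m, n)) (B : 'M[C]_(n, p)) (D : 'M[C]_(m, p)) :
  ip (A *m B) D = ip B (A^t* *m D).
Proof. by rewrite /ip adjmxM mulmxA. Qed.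

Lemma ipMr m n p (A : 'M[C]_(m, n)) (B : 'M[C]_(n, p)) (D : 'M[C]_(m, p)) :
  ip D (A *m B) = ip (A^t* *m D) B.
Proof. by rewrite ipC ipMl ipC. Qed.

Lemma ipMrr m n p (A : 'M[C]_(m, n)) (B : 'M[C]_(n, p)) (D : 'M[C]_(m, p)) :
  ip D (A *m B) = ip (D *m B^t*) A.
Proof.
by rewrite /ip adjmxM trmxCK mulmxA mxtrace_mulC mulmxA.
Qed.

Lemma ipMrl m n p (A : 'M[C]_(m, n)) (B : 'M[C]_(n, p)) (D : 'M[C]_(m, p)) :
  ip (A *m B) D = ip A (D *m B^t*).
Proof. by rewrite ipC ipMrr ipC. Qed.

Lemma cRe_sqr_ge0 (x : C) : 0 <= complex.Re (Num.conj x * x).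
Proof.
by case: x => a b /=; rewrite mulNr opprK addr_ge0 // -expr2 sqr_ge0.
Qed.

Lemma ip_ge0 m n (A : 'M[C]_(m, n)) : 0 <= ip A A.
Proof.
by rewrite ipE; apply: sumr_ge0 => i _; apply: sumr_ge0 => j _; apply: cRe_sqr_ge0.
Qed.

Lemma ip_eq0 m n (A : 'M[C]_(m, n)) : ip A A = 0 -> A = 0.
Proof.
rewrite ipE => /eqP; rewrite psumr_eq0 => [/allP h|i _]; last first.
  by apply: sumr_ge0 => j _; apply: cRe_sqr_ge0.
apply/matrixP => i j; rewrite mxE; move: (h i); rewrite mem_index_enum.
move=> /(_ isT) /=; rewrite psumr_eq0 => [/allP g|? _]; last exact: cRe_sqr_ge0.
move: (g j); rewrite mem_index_enum => /(_ isT) /=.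
case: (A i j) => a b /=; rewrite mulNr opprK -!expr2 paddr_eq0 ?sqr_ge0 //.
by rewrite !sqrf_eq0 => /andP[/eqP-> /eqP->].
Qed.

Definition rdiag n (d : 'I_n -> R) : 'M[C]_n := diag_mx (\row_i (d i)%:C).

Lemma adjmx_rdiag n (d : 'I_n -> R) : (rdiag d)^t* = rdiag d.
Proof.
rewrite tr_diag_mx map_diag_mx; congr diag_mx.
by apply/rowP => i; rewrite !mxE; exact: conj_real.
Qed.

Lemma mul_rdiag n (d e : 'I_n -> R) :
  rdiag d *m rdiag e = rdiag (fun i => d i * e i).
Proof.
rewrite /rdiag mulmx_diag; congr diag_mx; apply/rowP => i.
by rewrite !mxE -rmorphM.
Qed.

Lemma eq_rdiag n (d e : 'I_n -> R) : d =1 e -> rdiag d = rdiag e.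
Proof. by move=> h; congr diag_mx; apply/rowP => i; rewrite !mxE h. Qed.

Lemma rdiagD n (d e : 'I_n -> R) : rdiag d + rdiag e = rdiag (fun i => d i + e i).
Proof.
by rewrite /rdiag -linearD /=; congr diag_mx; apply/rowP => i; rewrite !mxE -rmorphD.
Qed.

Lemma rdiagN n (d : 'I_n -> R) : - rdiag d = rdiag (fun i => - d i).
Proof.
by rewrite /rdiag -linearN /=; congr diag_mx; apply/rowP => i; rewrite !mxE -rmorphN.
Qed.

Lemma rdiag_const n (a : R) : rdiag (fun _ : 'I_n => a) = a%:C%:M.
Proof.
by rewrite /rdiag -diag_const_mx; congr diag_mx; apply/rowP => i; rewrite !mxE.
Qed.

Lemma rdiag1 n : rdiag (fun _ : 'I_n => 1) = 1%:M.
Proof. exact: rdiag_const. Qed.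

(** For [v = U^t* *m x] with [U] unitary, this is the squared norm of the component of [x] along the
    [i]-th column of [U], the weight of the [i]-th eigenvalue in a quadratic form. *)
Definition rowsq m n (v : 'M[C]_(m, n)) (i : 'I_m) : R :=
  \sum_j complex.Re (Num.conj (v i j) * v i j).

Lemma rowsq_ge0 m n (v : 'M[C]_(m, n)) i : 0 <= rowsq v i.
Proof. by apply: sumr_ge0 => j _; apply: cRe_sqr_ge0. Qed.

Lemma ip_rowsq m n (v : 'M[C]_(m, n)) : ip v v = \sum_i rowsq v i.
Proof. exact: ipE. Qed.

Lemma ip_rdiag m n (d : 'I_m -> R) (v : 'M[C]_(m, n)) :
  ip v (rdiag d *m v) = \sum_i d i * rowsq v i.
Proof.
rewrite ipE; apply: eq_bigr => i _; rewrite big_distrr /=; apply: eq_bigr => j _.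
by rewrite /rdiag mul_diag_mx !mxE mulrCA cReZ.
Qed.

End InnerProduct.

(** * Sorted spectral decompositions *)

Section Spectral.
Variable R : realType.
Local Notation C := R[i].

Lemma char_poly_similar (F : comUnitRingType) n (P Q A : 'M[F]_n) :
  P *m Q = 1%:M -> char_poly (P *m A *m Q) = char_poly A.
Proof.
move=> PQ; have QP : Q *m P = 1%:M by apply: mulmx1C.
pose f := map_mx (@polyC F).
have fPQ : f _ _ P *m f _ _ Q = 1%:M by rewrite /f -map_mxM PQ map_mx1.
rewrite /char_poly.
have -> : char_poly_mx (P *m A *m Q) = f _ _ P *m char_poly_mx A *m f _ _ Q.
  rewrite /char_poly_mx mulmxBr mulmxBl /f -!map_mxM; congr (_ - _).
  by rewrite -/(f _ _ P) scalar_mxC -mulmxA fPQ mulmx1.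
rewrite !det_mulmx mulrAC -det_mulmx.
by rewrite fPQ det1 mul1r.
Qed.

Lemma eigvals_char_poly n (M N : 'M[C]_n) :
  char_poly M = char_poly N -> eigvals M = eigvals N.
Proof. by rewrite /eigvals => ->. Qed.

Lemma eigvals_unitary n (U A : 'M[C]_n) : U^t* *m U = 1%:M ->
  eigvals (U^t* *m A *m U) = eigvals A.
Proof. by move=> h; apply: eigvals_char_poly; apply: char_poly_similar. Qed.

Lemma char_poly_roots n (M : 'M[C]_n) :
  char_poly M =
    \prod_(z <- sval (closed_field_poly_normal (char_poly M))) ('X - z%:P).
Proof.
case: (closed_field_poly_normal (char_poly M)) => r rE /=.
by rewrite {1}rE (monicP (char_poly_monic M)) scale1r.
Qed.

(** By the degree of the characteristic polynomial the list of roots has exactly [n] entries, so the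
    tuple neither truncates it nor pads it with the default value. *)
Lemma eigvalsE n (M : 'M[C]_n) : eigvals M = sort >=%R
    [seq complex.Re z | z <- sval (closed_field_poly_normal (char_poly M))]
  :> seq R.
Proof.
have sz : size (sval (closed_field_poly_normal (char_poly M))) = n.
  by have := size_char_poly M; rewrite {1}char_poly_roots size_prod_XsubC => -[].
apply: (@eq_from_nth _ 0) => [|i]; rewrite size_tuple ?size_sort ?size_map //.
by move=> lt_in; rewrite (nth_map (Ordinal lt_in)) ?size_enum_ord ?nth_enum_ord.
Qed.

Lemma eigvals_sorted n (M : 'M[C]_n) (i j : 'I_n) :
  (i <= j)%N -> tnth (eigvals M) j <= tnth (eigvals M) i.
Proof.
move=> ij; rewrite !(tnth_nth 0).
apply: (sorted_leq_nth (leT := >=%R)) => //.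
- by move=> x y z /= h1 h2; apply: le_trans h2 h1.
- by move=> x; apply: lexx.
- by rewrite eigvalsE; apply: sort_sorted => x y /=; apply: le_total.
- by rewrite inE size_tuple.
- by rewrite inE size_tuple.
Qed.

Lemma perm_eq_eigvals n (M : 'M[C]_n) (d : 'I_n -> R) :
  char_poly M = \prod_(i < n) ('X - ((d i)%:C)%:P) ->
  perm_eq (eigvals M) [tuple d i | i < n].
Proof.
have -> : \prod_(i < n) ('X - ((d i)%:C : C)%:P) =
    \prod_(z <- [seq (d i)%:C | i <- enum 'I_n]) ('X - z%:P).
  by rewrite big_map big_enum.
rewrite eigvalsE perm_sort {1}char_poly_roots => /prod_XsubC_eq pe.
by rewrite (perm_trans (perm_map (@complex.Re R) pe)) // -map_comp perm_refl.
Qed.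

(** A sorted unitary diagonalization, kept as a relation so that the eigenvalues can be supplied by
    any function. *)
Definition spectrum n (H : 'M[C]_n) (l : 'I_n -> R) : Prop :=
  (forall i j : 'I_n, (i <= j)%N -> l j <= l i) /\
  exists U : 'M[C]_n,
    [/\ U^t* *m U = 1%:M, U *m U^t* = 1%:M & H = U *m rdiag l *m U^t*].

Lemma eq_spectrum n (H : 'M[C]_n) (l g : 'I_n -> R) :
  l =1 g -> spectrum H l -> spectrum H g.
Proof.
move=> lg [mono [U [UU UU' E]]]; split=> [i j ij|]; first by rewrite -!lg mono.
by exists U; rewrite -(eq_rdiag lg).
Qed.

(** The spectral theorem gives an unsorted diagonalization; conjugation by a permutation matrix puts
    its diagonal in the order of [eigvals]. *)
Lemma hermitian_spectrum n (H : 'M[C]_n) :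
  H^t* = H -> spectrum H (tnth (eigvals H)).
Proof.
move=> HH; split; first exact: eigvals_sorted.
have Hherm : H \is hermsymmx.
  by apply/is_hermitianmxP; rewrite expr0 scale1r HH.
have /orthomx_spectralP HE := hermitian_normalmx Hherm.
have /mxOverP real := hermitian_spectral_diag_real Hherm.
set P := spectralmx H in HE; set sp := spectral_diag H in HE real.
have Pu : P \is unitarymx by apply: spectral_unitarymx.
have PP : P *m P^t* = 1%:M by apply/unitarymxP.
have PP' : P^t* *m P = 1%:M by apply: mulmx1C.
rewrite (invmx_unitary Pu) in HE.
pose d i := complex.Re (sp 0 i).
have dE : diag_mx sp = rdiag d.
  by congr diag_mx; apply/rowP => i; rewrite !mxE RRe_real ?real.
(* Both lists consist of the roots of one polynomial, so a permutation [s] relates them. *)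
have /perm_eq_eigvals/tuple_permP [s sE] :
    char_poly H = \prod_(i < n) ('X - ((d i)%:C)%:P).
  rewrite HE char_poly_similar // dE char_poly_trig ?diag_mx_is_trig //.
  by apply: eq_bigr => i _; rewrite !mxE eqxx mulr1n.
have sE' i : tnth (eigvals H) i = d (s i).
  by rewrite (tnth_nth 0) sE -tnth_nth !tnth_mktuple.
pose S : 'M[C]_n := perm_mx s.
have Sadj : S^t* = perm_mx (s^-1)%g by rewrite tr_perm_mx map_perm_mx.
have SS : S *m S^t* = 1%:M by rewrite Sadj -perm_mxM mulgV perm_mx1.
have SS' : S^t* *m S = 1%:M by apply: mulmx1C.
exists (P^t* *m S^t*); rewrite adjmxM !trmxCK.
have PSP : P^t* *m S^t* *m (S *m P) = 1%:M.
  by rewrite mulmxA -[_ *m _ *m S]mulmxA SS' mulmx1.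
split=> //; first exact: mulmx1C.
rewrite {1}HE dE !mulmxA; congr (_ *m _); rewrite -!mulmxA; congr (_ *m _).
suff SD : S *m rdiag d = rdiag (tnth (eigvals H)) *m S.
  by rewrite -SD mulmxA SS' mul1mx.
apply/matrixP => i j; rewrite -row_permE /rdiag mul_diag_mx !mxE sE'.
by case: eqVneq; rewrite ?mulr1n ?mulr0n (mulr1, mulr0).
Qed.

End Spectral.

(** * Sorting and weighted sums *)

Section Rearrangement.
Variable R : realType.

Lemma sort_perm n (x : 'I_n -> R) : exists s : 'S_n,
  (forall i j : 'I_n, (i <= j)%N -> x (s j) <= x (s i)) /\
  sort >=%R [tuple x i | i < n] = [tuple x (s i) | i < n].
Proof.
have /tuple_permP [s sE] : perm_eq (sort >=%R [tuple x i | i < n]) [tuple x i | i < n].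
  by rewrite perm_sort perm_refl.
have E : sort >=%R [tuple x i | i < n] = [tuple x (s i) | i < n] :> seq R.
  by rewrite sE; apply: eq_map => i; rewrite tnth_mktuple.
exists s; split=> // i j ij.
have: sorted >=%R [tuple x (s i) | i < n].
  by rewrite -E; apply: sort_sorted => u v /=; apply: le_total.
have xE (a : 'I_n) : x (s a) = [tuple x (s i) | i < n]`_a.
  by rewrite -tnth_nth tnth_mktuple.
rewrite !xE => srt; apply: (sorted_leq_nth (leT := >=%R)); rewrite ?inE ?size_tuple //.
- by move=> u v w /= h1 h2; apply: le_trans h2 h1.
- by move=> u; apply: lexx.
Qed.

Lemma sum_lt_const n m (c : R) : (m <= n)%N ->
  \sum_(i < n | (i < m)%N) c = m%:R * c.
Proof.
move=> mn; rewrite -(big_ord_widen n (fun=> c) mn) sumr_const card_ord.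
by rewrite mulr_natl.
Qed.

(* Both sides are compared after subtracting the threshold value
   [lam (m - 1)], which makes the inequality termwise. *)
Lemma weighted_sum_le n m (lam w : 'I_n -> R) : (m <= n)%N ->
  (forall i j : 'I_n, (i <= j)%N -> lam j <= lam i) ->
  (forall i, 0 <= w i <= 1) -> \sum_i w i = m%:R ->
  \sum_i lam i * w i <= \sum_(i < n | (i < m)%N) lam i.
Proof.
move=> mn mono w01 wm; case: m => [|m] in mn wm *.
  rewrite [leRHS]big_pred0 // big1 // => i _.
  have /eqP := wm; rewrite psumr_eq0 => [/allP/(_ i)|k _]; last by case/andP: (w01 k).
  by rewrite mem_index_enum => /(_ isT)/eqP->; rewrite mulr0.
pose mu := lam (Ordinal mn).
rewrite -(lerD2r (- (m.+1%:R * mu))) -{1}wm mulr_suml -(sum_lt_const mu mn) -!sumrB.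
rewrite [leRHS]big_mkcond /=; apply: ler_sum => i _.
have /andP[w0 w1] := w01 i.
rewrite [_ * mu]mulrC -mulrBl; case: ifP => im.
  by rewrite ler_piMr // subr_ge0 mono.
by rewrite mulr_le0_ge0 // subr_le0 mono //= ltnW // ltnNge -ltnS im.
Qed.

(** Two thresholds are used, [mu] for the weights [p] and [nu] for [q]: the [m]-th values of [lam]
    from the top and from the bottom. After subtracting them both sums compare termwise. As the
    total weights agree, the remainder is [mu - nu] times [\sum_i p i], and [mu - nu] is nonnegative
    because [m.*2 <= n]. *)
Lemma spread_sum_le n m (lam p q : 'I_n -> R) : (m.*2 <= n)%N ->
  (forall i j : 'I_n, (i <= j)%N -> lam j <= lam i) ->
  (forall i, 0 <= p i <= 1) -> (forall i, 0 <= q i <= 1) ->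
  \sum_i p i = \sum_i q i -> \sum_i p i <= m%:R ->
  \sum_i lam i * (p i - q i) <=
    \sum_(i < n | (i < m)%N) (lam i - lam (rev_ord i)).
Proof.
move=> mn mono p01 q01 pq pm; case: m => [|m] in mn pm *.
  rewrite [leRHS]big_pred0 // big1 // => i _.
  have p0 : \sum_i p i == 0.
    by rewrite eq_le pm sumr_ge0 // => k _; case/andP: (p01 k).
  have q0 : \sum_i q i == 0 by rewrite -pq.
  move: p0 q0; rewrite !psumr_eq0 => [/allP/(_ i)+/allP/(_ i)|k _|k _].
  - by rewrite mem_index_enum => /(_ isT)/eqP-> /(_ isT)/eqP->; rewrite subr0 mulr0.
  - by case/andP: (q01 k).
  - by case/andP: (p01 k).
have mn1 : (m < n)%N by lia.
pose a := Ordinal mn1; pose mu := lam a; pose nu := lam (rev_ord a).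
have nm : nu <= mu by apply: mono => /=; lia.
have E : \sum_i lam i * (p i - q i) =
  \sum_i (lam i - mu) * p i + \sum_i (nu - lam i) * q i + (mu - nu) * \sum_i p i.
  rewrite mulrBl {2}pq !mulr_sumr -sumrB -!big_split /=.
  by apply: eq_bigr => i _; ring.
have H1 : \sum_i (lam i - mu) * p i <= \sum_(i < n | (i < m.+1)%N) (lam i - mu).
  rewrite [leRHS]big_mkcond /=; apply: ler_sum => i _; have /andP[w0 w1] := p01 i.
  case: ifP => im; first by rewrite ler_piMr // subr_ge0 mono.
  by rewrite mulr_le0_ge0 // subr_le0 mono //=; lia.
have H2 : \sum_i (nu - lam i) * q i <=
    \sum_(i < n | (i < m.+1)%N) (nu - lam (rev_ord i)).
  rewrite (reindex_inj rev_ord_inj) /= [leRHS]big_mkcond /=.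
  apply: ler_sum => i _; have /andP[w0 w1] := q01 (rev_ord i).
  case: ifP => im; first by rewrite ler_piMr // subr_ge0 mono //=; lia.
  by rewrite mulr_le0_ge0 // subr_le0 mono //=; have := ltn_ord i; lia.
have H3 : (mu - nu) * \sum_i p i <= \sum_(i < n | (i < m.+1)%N) (mu - nu).
  by rewrite sum_lt_const // mulrC ler_wpM2r // subr_ge0.
rewrite E; apply: le_trans (lerD (lerD H1 H2) H3) _.
rewrite -!big_split /=; apply: ler_sum => i _; lra.
Qed.

Lemma sort_sum_ge n m (x : 'I_n -> R) : (m <= n)%N ->
  \sum_(i < n | (i < m)%N) x i <= \sum_(i < m) (sort >=%R [tuple x i | i < n])`_i.
Proof.
move=> mn; have [s [mono ->]] := sort_perm x.
rewrite (big_ord_widen n (nth 0 _) mn) big_mkcond /=.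
under [leRHS]eq_bigr do rewrite nth_mktuple.
(* The indicator of the sorted positions that hold one of the first [m] original entries. *)
pose w (i : 'I_n) : R := (s i < m)%N%:R.
apply: le_trans (weighted_sum_le (w := w) mn mono _ _).
- rewrite (reindex_inj (@perm_inj _ s)) /=; apply: ler_sum => i _.
  by rewrite /w; case: ifP; rewrite ?mulr1 ?mulr0.
- by move=> i; rewrite /w; case: (_ < _)%N; rewrite ?lexx ?ler01.
- rewrite /w -(reindex_inj (P := xpredT) (F := fun i : 'I_n => (i < m)%N%:R)
    (@perm_inj _ s)) /=.
  rewrite -[RHS]mulr1 -(sum_lt_const _ mn) [RHS]big_mkcond /=.
  by apply: eq_bigr => i _; case: (_ < _)%N.
Qed.

(** This turns the left side of a submajorization into a sum over an index set, the form bounded by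
    the Lidskii-Mirsky theorem. *)
Lemma sort_sum_eq n m (x : 'I_n -> R) : (m <= n)%N -> exists2 J : {set 'I_n},
  #|J| = m & \sum_(i < m) (sort >=%R [tuple x i | i < n])`_i = \sum_(i in J) x i.
Proof.
move=> mn; have [s [_ ->]] := sort_perm x.
exists [set s (widen_ord mn i) | i : 'I_m].
  rewrite card_imset ?card_ord // => i j /perm_inj /(congr1 val) /= ij.
  exact: val_inj.
rewrite big_imset /= => [|i j _ _ /perm_inj /(congr1 val) /= ij]; last exact: val_inj.
apply: eq_bigr => i _.
by rewrite -(nth_mktuple (fun i => x (s i)) 0 (widen_ord mn i)).
Qed.

End Rearrangement.

(** * Weyl and Lidskii-Mirsky inequalities *)

Section Perturbation.
Variable R : realType.
Local Notation C := R[i].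

Lemma ip_spectral n m (U : 'M[C]_n) (l : 'I_n -> R) (v : 'M[C]_(n, m)) :
  ip v (U *m rdiag l *m U^t* *m v) = \sum_i l i * rowsq (U^t* *m v) i.
Proof. by rewrite -!mulmxA ipMr -[U^t* *m v]/(U^t* *m v) ip_rdiag. Qed.

Lemma ip_unitary n m (U : 'M[C]_n) (v : 'M[C]_(n, m)) : U *m U^t* = 1%:M ->
  ip v v = \sum_i rowsq (U^t* *m v) i.
Proof. by move=> UU; rewrite -ip_rowsq ipMl trmxCK mulmxA UU mul1mx. Qed.

(* The [n - 1] linear conditions "[x] is orthogonal to the eigenvectors of [N]
   before the [i]-th and to those of [M] after the [i]-th" have a common
   nonzero solution, at which both quadratic forms can be estimated. *)
Lemma spectrum_monotone n (M N : 'M[C]_n) (l g : 'I_n -> R) (t : R) :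
  spectrum M l -> spectrum N g ->
  (forall v : 'cV[C]_n, ip v (M *m v) <= ip v (N *m v) + t * ip v v) ->
  forall i, l i <= g i + t.
Proof.
move=> [ldec [U [_ UU ->]]] [gdec [V [_ VV ->]]] le_MN i.
pose T : 'M[C]_n := \matrix_a
  if (a < i)%N then row a (V^t*) else if a == i then 0 else row a (U^t*).
have : \det T^T == 0.
  rewrite det_tr; apply/det0P; exists (delta_mx 0 i).
    by apply/eqP => /matrixP/(_ 0 i)/eqP; rewrite !mxE !eqxx oner_eq0.
  by rewrite -rowE rowK ltnn eqxx.
case/det0P => y y0 Ty; pose x := y^T.
have Tx : T *m x = 0 by rewrite -[T]trmxK -trmx_mul Ty trmx0.
have rowT a : row a T *m x = 0 by rewrite -row_mul Tx linear0.
have rowsq0 (W : 'M[C]_n) a : row a W *m x = 0 -> rowsq (W *m x) a = 0.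
  rewrite -row_mul => h; rewrite /rowsq big1 // => j _.
  by have /rowP/(_ j) := h; rewrite !mxE => ->; rewrite mulr0.
have Vx (a : 'I_n) : (a < i)%N -> rowsq (V^t* *m x) a = 0.
  by move=> ai; apply: rowsq0; have := rowT a; rewrite rowK ai.
have Ux (a : 'I_n) : (i < a)%N -> rowsq (U^t* *m x) a = 0.
  move=> ia; apply: rowsq0; have := rowT a; rewrite rowK ltnNge (ltnW ia) /=.
  by rewrite -val_eqE gtn_eqF.
have x_gt0 : 0 < ip x x.
  rewrite lt_neqAle ip_ge0 andbT eq_sym; apply: contra y0 => /eqP/ip_eq0 x0.
  by rewrite -[y]trmxK -/x x0 trmx0.
have geM : l i * ip x x <= ip x (U *m rdiag l *m U^t* *m x).
  rewrite ip_spectral (ip_unitary _ UU) mulr_sumr; apply: ler_sum => a _.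
  have [ia|ai] := ltnP i a; first by rewrite Ux // !mulr0.
  by apply: ler_wpM2r; [exact: rowsq_ge0 | auto].
have leN : ip x (V *m rdiag g *m V^t* *m x) <= g i * ip x x.
  rewrite ip_spectral (ip_unitary _ VV) mulr_sumr; apply: ler_sum => a _.
  have [ai|ia] := ltnP a i; first by rewrite Vx // !mulr0.
  by apply: ler_wpM2r; [exact: rowsq_ge0 | auto].
rewrite -(ler_pM2r x_gt0) mulrDl.
by apply: le_trans geM (le_trans (le_MN x) _); rewrite lerD2r.
Qed.

Lemma sum_spectrum n (H : 'M[C]_n) (l : 'I_n -> R) : spectrum H l ->
  \sum_i l i = complex.Re (\tr H).
Proof.
move=> [_ [U [UU' UU HE]]].
have -> : complex.Re (\tr H) = ip 1%:M (H *m 1%:M).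
  by rewrite /ip adjmx1 mul1mx mulmx1.
rewrite HE ip_spectral; apply: eq_bigr => i _.
rewrite -[LHS]mulr1; congr (_ * _).
have /matrixP/(_ i i) := UU'; rewrite !mxE eqxx => /(congr1 (@complex.Re R)).
rewrite cRe_sum mulmx1 /= => <-.
by apply: eq_bigr => j _; rewrite !mxE -[RHS]cRe_conj rmorphM /= !conjCK.
Qed.

(** Let [P] be the part of [M - N] above the level [t]. Then [N + P] dominates [N], and [N + P + t]
    dominates [M], so its eigenvalues [h] satisfy [g i <= h i] and [l i <= h i + t]. The sum of
    [h i - g i] over [J] is at most the sum over all indices, which is the trace of [P]. *)
Lemma sum_spectrum_sub_le n (M N V : 'M[C]_n) (l g d : 'I_n -> R) (t : R)
    (J : {set 'I_n}) : N^t* = N -> spectrum M l -> spectrum N g ->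
  V *m V^t* = 1%:M -> M - N = V *m rdiag d *m V^t* ->
  \sum_(i in J) (l i - g i) <= t *+ #|J| + \sum_i Num.max (d i - t) 0.
Proof.
move=> hN hl hg VV MN; pose e i := Num.max (d i - t) 0.
have e0 i : 0 <= e i by rewrite le_max lexx orbT.
have VV' : V^t* *m V = 1%:M by apply: mulmx1C.
have [P [hP ipP trP]] : exists P : 'M[C]_n, [/\ P^t* = P,
    forall v : 'cV_n, ip v (P *m v) = \sum_i e i * rowsq (V^t* *m v) i &
    complex.Re (\tr P) = \sum_i e i].
  exists (V *m rdiag e *m V^t*); split=> [|v|].
  - by rewrite !adjmxM trmxCK adjmx_rdiag mulmxA.
  - exact: ip_spectral.
  - rewrite mxtrace_mulC mulmxA VV' mul1mx mxtrace_diag cRe_sum.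
    by apply: eq_bigr => i _; rewrite !mxE.
have hNP : (N + P)^t* = N + P by rewrite adjmxD hN hP.
have [h hh] : exists h, spectrum (N + P) h.
  by exists (tnth (eigvals (N + P))); apply: hermitian_spectrum.
have leM i : l i <= h i + t.
  apply: (spectrum_monotone hl hh) => v.
  have -> : ip v (M *m v) = ip v (N *m v) + \sum_i d i * rowsq (V^t* *m v) i.
    by rewrite -ip_spectral -MN mulmxBl ipDr ipNr addrC subrK.
  rewrite mulmxDl ipDr -addrA lerD2l ipP (ip_unitary _ VV) mulr_sumr -big_split /=.
  apply: ler_sum => i' _; rewrite -mulrDl ler_wpM2r ?rowsq_ge0 //.
  by rewrite -lerBlDr /e le_max lexx.
have leN i : g i <= h i.
  rewrite -[leRHS]addr0; apply: (spectrum_monotone hg hh) => v.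
  rewrite mul0r addr0 mulmxDl ipDr lerDl ipP.
  by apply: sumr_ge0 => i' _; rewrite mulr_ge0 ?rowsq_ge0.
have sumP : \sum_i h i = \sum_i g i + \sum_i e i.
  by have := sum_spectrum hh; rewrite mxtraceD cReD trP -(sum_spectrum hg).
have -> : \sum_i Num.max (d i - t) 0 = \sum_i (h i - g i).
  by rewrite sumrB sumP addrC addKr.
rewrite -sumr_const [X in _ <= _ + X](bigID (mem J)) /= addrA -big_split /=.
rewrite -[leLHS]addr0; apply: lerD; last by apply: sumr_ge0 => i _; rewrite subr_ge0.
by apply: ler_sum => i _; have := leM i; lra.
Qed.

(* The Lidskii-Mirsky theorem: the two isometries realise the sum of the [j]
   largest singular values of [M - N]. *)
Lemma lidskii_mirsky n (M N : 'M[C]_n) (l g : 'I_n -> R) j (J : {set 'I_n}) :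
  M^t* = M -> N^t* = N -> spectrum M l -> spectrum N g -> #|J| = j ->
  exists U1 U2 : 'M[C]_(n, j),
  [/\ U1^t* *m U1 = 1%:M, U2^t* *m U2 = 1%:M &
    \sum_(i in J) `|l i - g i| <=
      ip U2 ((M - N) *m U1)].
Proof.
move=> hM hN hl hg cJ; have jn : (j <= n)%N.
  by rewrite -cJ -[leqRHS](card_ord n) max_card.
have hD : (M - N)^t* = M - N by rewrite adjmxD adjmxN hM hN.
have [d [_ [V [VV' VV DE]]]] : exists d, spectrum (M - N) d.
  by exists (tnth (eigvals (M - N))); apply: hermitian_spectrum.
have [s [mono _]] := sort_perm (fun i => `|d i|).
pose f (i : 'I_j) := s (widen_ord jn i).
have f_inj : injective f.
  by move=> a b /perm_inj /(congr1 val) /= ab; apply: val_inj.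
(* Eigenvectors of [M - N] for the [j] eigenvalues of largest absolute value. *)
pose W := colsub f V.
have WE : W = V *m colsub f 1%:M by rewrite mulmx_colsub mulmx1.
have WW : W^t* *m W = 1%:M.
  apply/matrixP => a b; have /matrixP/(_ (f a) (f b)) := VV'.
  rewrite !mxE (inj_eq f_inj) => <-; apply: eq_bigr => i _.
  by rewrite !mxE.
have DW : (M - N) *m W = W *m rdiag (fun i => d (f i)).
  rewrite {1}DE WE -!mulmxA [V^t* *m _]mulmxA VV' mul1mx; congr (_ *m _).
  apply/matrixP => a b; rewrite /rdiag mul_diag_mx mul_mx_diag !mxE mulrC.
  by case: eqVneq => [->|_]; rewrite ?mul1r // !mul0r.
(* The signs of these eigenvalues, absorbed into the second isometry so that the trace adds absolute
   values. *)
pose eps (i : 'I_j) : R := if 0 <= d (f i) then 1 else -1.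
exists W, (W *m rdiag eps); split=> //.
  rewrite adjmxM adjmx_rdiag -mulmxA [_ *m (W *m _)]mulmxA WW mul1mx mul_rdiag.
  rewrite -rdiag1; apply: eq_rdiag => i; rewrite /eps.
  by case: ifP; rewrite ?mulrNN mulr1.
have -> : ip (W *m rdiag eps) ((M - N) *m W) = \sum_i `|d (f i)|.
  rewrite DW ipMl mulmxA WW mul1mx -[rdiag eps]mulmx1 ipMl adjmx_rdiag mul_rdiag.
  rewrite /ip adjmx1 mul1mx mxtrace_diag cRe_sum; apply: eq_bigr => i _.
  rewrite !mxE /= /eps; case: ifPn => h; first by rewrite mul1r ger0_norm.
  by rewrite mulN1r ltr0_norm // ltNge.
(* The threshold below sits at position [j - 1], so an empty [J] is treated apart. *)
have [j0|j_gt0] := posnP j.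
  rewrite big1 ?sumr_ge0 // => i iJ.
  by move: cJ; rewrite j0 => /eqP; rewrite cards_eq0 => /eqP J0; rewrite J0 inE in iJ.
have j1n : (j.-1 < n)%N by lia.
(* With the [j]-th largest absolute value as level, the excesses over [t] come only from the first
   [j] sorted positions. *)
pose t := `|d (s (Ordinal j1n))|.
(* The one-sided bound is applied to [M - N] where [l i - g i] is nonnegative and to [N - M] on the
   rest of [J]. *)
pose J1 := [set i in J | g i <= l i].
have J1J : J :&: J1 = J1.
  by apply/setIidPr/subsetP => i; rewrite inE => /andP[].
have D1 := sum_spectrum_sub_le t J1 hN hl hg VV DE.
have DE' : N - M = V *m rdiag (fun i => - d i) *m V^t*.
  by rewrite -opprB {1}DE -rdiagN mulmxN mulNmx.
have D2 := sum_spectrum_sub_le t (J :\: J1) hM hg hl VV DE'.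
have -> : \sum_(i in J) `|l i - g i| =
    \sum_(i in J1) (l i - g i) +
    \sum_(i in J :\: J1) (g i - l i).
  rewrite (big_setID J1) /=; congr (_ + _).
    rewrite J1J.
    by apply: eq_bigr => i; rewrite inE => /andP[_ h]; rewrite ger0_norm ?subr_ge0.
  apply: eq_bigr => i; rewrite !inE => /andP[+ iJ]; rewrite iJ /= => h.
  by rewrite distrC gtr0_norm ?subr_gt0 // ltNge.
apply: le_trans (lerD D1 D2) _.
have cJJ : (#|J1| + #|J :\: J1| = j)%N.
  by rewrite -cJ -(cardsID J1 J) J1J.
rewrite addrACA -mulrnDr cJJ -big_split /=.
have -> : \sum_i `|d (f i)| = t *+ j + \sum_i (`|d (f i)| - t).
  by rewrite sumrB sumr_const card_ord addrC subrK.
rewrite lerD2l.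
have -> : \sum_i (`|d (f i)| - t) = \sum_(i < n | (i < j)%N) (`|d (s i)| - t).
  by rewrite (big_ord_narrow jn).
rewrite [leRHS]big_mkcond (reindex_inj (@perm_inj _ s)) /=.
apply: ler_sum => i _.
have := normr_ge0 (d (s (Ordinal j1n))); rewrite -/t => t0.
(* Since [t] is nonnegative, at most one of [d] and [- d] can exceed it. *)
have le_max_abs : Num.max (d (s i) - t) 0 + Num.max (- d (s i) - t) 0 <=
    Num.max (`|d (s i)| - t) 0.
  have [h|h] := ger0P (d (s i)).
    by rewrite [X in _ + X]max_r ?addr0 //; lra.
  by rewrite [X in X + _]max_r ?add0r //; lra.
apply: le_trans le_max_abs _; case: ifPn => ij.
  by rewrite ge_max lexx subr_ge0 mono //=; lia.
by rewrite ge_max lexx subr_le0 mono //=; lia.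
Qed.

End Perturbation.

(** * Off-diagonal blocks and the spectral spread *)

Section Spread.
Variable R : realType.
Local Notation C := R[i].

(** The operator inequality [a^* a <= K], so [K] bounds the square of the norm. Letting [v] have any
    width makes it apply to vectors and to Frobenius norms of products alike. *)
Definition bounded p n (K : R) (a : 'M[C]_(p, n)) : Prop :=
  forall m (v : 'M[C]_(n, m)), ip (a *m v) (a *m v) <= K * ip v v.

Lemma bounded_gram p n (K : R) (a : 'M[C]_(p, n)) (e : 'I_n -> R) :
  a^t* *m a = rdiag e -> (forall i, e i <= K) -> bounded K a.
Proof.
move=> aa eK m v; rewrite ipMl mulmxA aa ip_rdiag ip_rowsq mulr_sumr.
by apply: ler_sum => i _; rewrite ler_wpM2r ?rowsq_ge0.
Qed.

Lemma bounded_isometry p n (a : 'M[C]_(p, n)) : a^t* *m a = 1%:M -> bounded 1 a.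
Proof. by move=> aa m v; rewrite ipMl mulmxA aa mul1mx mul1r. Qed.

Lemma bounded1 p n m (a : 'M[C]_(p, n)) (v : 'M[C]_(n, m)) :
  bounded 1 a -> ip (a *m v) (a *m v) <= ip v v.
Proof. by move=> /(_ m v); rewrite mul1r. Qed.

Lemma boundedM p n q (a : 'M[C]_(p, n)) (b : 'M[C]_(n, q)) :
  bounded 1 a -> bounded 1 b -> bounded 1 (a *m b).
Proof.
by move=> ha hb m v; rewrite -mulmxA (le_trans (ha _ _)) // mul1r hb.
Qed.

(** Expand the squared norm of [K v - a a^* v], which is nonnegative, and apply the bound on [a] to
    the vector [a^* v]. *)
Lemma bounded_adj p n (K : R) (a : 'M[C]_(p, n)) : 0 < K ->
  bounded K a -> bounded K (a^t*).
Proof.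
move=> K0 ha m v; set u := a^t* *m v.
have uu : ip v (a *m u) = ip u u by rewrite ipMr.
have := ip_ge0 (K%:C *: v - a *m u).
rewrite ipDl !ipDr !ipNl !ipNr opprK !ipZl !ipZr (ipC (a *m u) v) uu.
move=> h0; rewrite -(ler_pM2l K0); have := ha _ u; move: h0.
by move: (ip (a *m u) _) (ip u u) (ip v v) => x y z; clear; lra.
Qed.

(** Reads the norm of a row as that of the adjoint at a basis vector, so that a bound on the adjoint
    controls the spectral weights. *)
Lemma rowsq_delta p n (M : 'M[C]_(p, n)) i :
  rowsq M i = ip (M^t* *m (delta_mx i 0 : 'cV_p)) (M^t* *m delta_mx i 0).
Proof.
rewrite -colE ipE /rowsq; apply: eq_bigr => j _; rewrite big_ord1 !mxE.
by rewrite -[LHS]cRe_conj rmorphM /= !conjCK.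
Qed.

Lemma ip_delta p (i : 'I_p) :
  ip (delta_mx i 0 : 'cV[C]_p) (delta_mx i 0) = 1.
Proof. by rewrite /ip trmx_delta map_delta_mx mul_delta_mx trace_mx11 !mxE !eqxx. Qed.

Lemma ip_adj_eq0 p n (a b : 'M[C]_(p, n)) : a^t* *m b = 0 -> ip a b = 0.
Proof. by move=> ab; rewrite /ip ab mxtrace0. Qed.

Lemma adjmx_eq0 p n m (a : 'M[C]_(p, n)) (b : 'M[C]_(p, m)) :
  a^t* *m b = 0 -> b^t* *m a = 0.
Proof.
by move=> ab; rewrite -[b^t* *m a]trmxCK adjmxM trmxCK ab trmx0 map_mx0.
Qed.

(* With [w = a + b] and [w' = a - b] one has
   [4 Re tr (b^* H a) = tr (w^* H w) - tr (w'^* H w')], and the two terms are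
   averages of the eigenvalues of [H] with weights at most [2] and the same
   total weight. *)
Lemma spread_bound p n m (H : 'M[C]_p) (L : nat -> R) (a b : 'M[C]_(p, n)) :
  H^t* = H -> spectrum H (fun i => L i) -> a^t* *m b = 0 -> bounded 1 a -> bounded 1 b ->
  ip a a <= m%:R -> ip b b <= m%:R -> (m.*2 <= p)%N ->
  2 * ip b (H *m a) <=
    \sum_(i < m) (L i - L (p - i.+1)%N).
Proof.
move=> hH [Ldec [U [UU' UU HE]]] ab ha hb am bm mp.
have mp1 : (m <= p)%N by lia.
have ba := adjmx_eq0 ab.
(* The weights are halved so that [bounded 2] places them between 0 and 1. *)
have [wt [wtE wt_sum wt01]] : exists wt : 'M[C]_(p, n) -> 'I_p -> R,
    [/\ forall w, ip w (H *m w) = 2 * \sum_(i < p) L i * wt w i,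
        forall w, \sum_i wt w i = ip w w / 2 &
        forall w, bounded 2 w -> forall i, 0 <= wt w i <= 1].
  exists (fun w i => rowsq (U^t* *m w) i / 2); split=> [w|w|w hw i].
  - rewrite {1}HE ip_spectral mulr_sumr; apply: eq_bigr => i _.
    by field.
  - by rewrite (ip_unitary w UU) mulr_suml.
  - rewrite divr_ge0 ?rowsq_ge0 //= ler_pdivrMr // mul1r.
    rewrite rowsq_delta adjmxM trmxCK -mulmxA.
    apply: le_trans (bounded_adj _ hw _) _ => //.
    by rewrite ipMl mulmxA UU' mul1mx ip_delta mulr1.
(* Orthogonality of the ranges removes the cross terms, so the squared norms of the two contractions
   add up. *)
have bD : bounded 2 (a + b).
  move=> q v; rewrite mulmxDl ipDl !ipDr (ipC (b *m v)).
  have -> : ip (a *m v) (b *m v) = 0 by rewrite ipMl mulmxA ab mul0mx ipC ip0l.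
  have := ha _ v; have := hb _ v.
  by move: (ip (a *m v) _) (ip (b *m v) _) (ip v v) => x y z; clear; lra.
have bB : bounded 2 (a - b).
  move=> q v; rewrite mulmxBl ipDl !ipDr !ipNl !ipNr (ipC (b *m v)).
  have -> : ip (a *m v) (b *m v) = 0 by rewrite ipMl mulmxA ab mul0mx ipC ip0l.
  have := ha _ v; have := hb _ v.
  by move: (ip (a *m v) _) (ip (b *m v) _) (ip v v) => x y z; clear; lra.
have ab0 := ip_adj_eq0 ab; have ba0 := ip_adj_eq0 ba.
have sD : ip (a + b) (a + b) = ip a a + ip b b.
  by rewrite ipDl !ipDr ab0 ba0; ring.
have sB : ip (a - b) (a - b) = ip a a + ip b b.
  by rewrite ipDl !ipDr !ipNl !ipNr ab0 ba0; ring.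
have Hab : ip a (H *m b) = ip b (H *m a) by rewrite ipMr hH ipC.
have E : 2 * ip b (H *m a) =
    \sum_(i < p) L i * (wt (a + b) i - wt (a - b) i).
  under eq_bigr do rewrite mulrBr.
  rewrite sumrB.
  have := wtE (a + b); have := wtE (a - b).
  rewrite mulmxBr mulmxDr !ipDl !ipDr !ipNl !ipNr Hab.
  move: (ip a _) (ip b (H *m a)) (ip b (H *m b)) => u v z.
  by move: (\sum_i _) (\sum_i _) => S1 S2; clear; lra.
rewrite E; apply: le_trans (spread_sum_le mp _ _ _ _ _) _.
- exact: Ldec.
- exact: wt01.
- exact: wt01.
- by rewrite wt_sum sD -sB -wt_sum.
- by rewrite (wt_sum (a + b)) sD; move: (ip a a) (ip b b) am bm => u v; clear; lra.
by rewrite (big_ord_widen p (fun i => L i - L (p - i.+1)%N) mp1).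
Qed.

Lemma rdiag_unit n (d : 'I_n -> R) : (forall i, d i != 0) -> rdiag d \in unitmx.
Proof.
move=> d0; rewrite unitmxE unitfE det_diag; apply/prodf_neq0 => i _.
by rewrite mxE eq_complex /= negb_and d0.
Qed.

Lemma gram_size p n (M : 'M[C]_(p, n)) : M^t* *m M \in unitmx -> (n <= p)%N.
Proof.
move=> /mxrank_unit => <-; apply: leq_trans (mxrankM_maxr _ _) _.
exact: rank_leq_row.
Qed.

(* The columns of [f] and [g] are those of [X + Y] and [X - Y] when
   [X^* Y = diag c]; [s i] is then the sine of half the [i]-th angle. *)
Lemma half_angle_support p k (f g : 'M[C]_(p, k)) (c s : nat -> R) :
  f^t* *m g = 0 ->
  f^t* *m f = rdiag (fun i : 'I_k => 2 + 2 * c i) ->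
  g^t* *m g = rdiag (fun i : 'I_k => 2 - 2 * c i) ->
  (forall i, 0 <= c i <= 1) ->
  (forall i, 0 <= s i) -> (forall i l, (i <= l)%N -> s l <= s i) ->
  (forall i, (i < k)%N -> 1 - c i = 2 * s i ^+ 2) ->
  forall l, (l < k)%N -> s l != 0 -> (l.+1.*2 <= p)%N.
Proof.
move=> fg ff gg c01 s0 smono cs l lk sl.
(* The [k] columns of [f] and the first [l.+1] columns of [g] are nonzero and pairwise orthogonal,
   hence independent; the claim follows since [l < k]. *)
suff : (k + l.+1 <= p)%N by lia.
pose w := widen_ord lk; pose g1 := colsub w g.
have g1g1 : g1^t* *m g1 = rdiag (fun i : 'I_l.+1 => 2 - 2 * c i).
  apply/matrixP => a b; have /matrixP/(_ (w a) (w b)) := gg.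
  by rewrite !mxE => <-; apply: eq_bigr => i _; rewrite !mxE.
have fg1 : f^t* *m g1 = 0 by rewrite mulmx_colsub fg; apply/matrixP => ? ?; rewrite !mxE.
apply: (gram_size (M := row_mx f g1)).
rewrite tr_row_mx map_col_mx mul_col_row ff fg1 (adjmx_eq0 fg1) g1g1.
rewrite unitmxE det_ublock unitrM -!unitmxE !rdiag_unit // => i.
  have /= -> : 2 - 2 * c i = 4 * s i ^+ 2.
    by have := cs i (ltn_ord (w i)); move: (c i) (s i) => x y; clear; lra.
  rewrite mulf_neq0 ?pnatr_eq0 ?expf_neq0 // gt_eqF //.
  apply: lt_le_trans (smono i l _); last by rewrite -ltnS.
  by rewrite lt_neqAle eq_sym sl s0.
by have /andP[ci _] := c01 i; rewrite gt_eqF // ltr_pwDl // mulr_ge0.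
Qed.

(** Write [f = 2 h] and [g = G diag (2 s_i)] with contractions [h] and [G], and expand [diag (s_i)]
    as a nonnegative combination of the coordinate projections [E l] with coefficients [delta l].
    Each [E l] contributes at most the first [minn l.+1 j] spread entries, and exchanging the sums
    restores the weights [s i]. *)
Lemma half_angle_bound p k j (H : 'M[C]_p) (L : nat -> R) (f g : 'M[C]_(p, k))
    (c s : nat -> R) (U1 U2 : 'M[C]_(k, j)) :
  H^t* = H -> spectrum H (fun i => L i) -> f^t* *m g = 0 ->
  f^t* *m f = rdiag (fun i : 'I_k => 2 + 2 * c i) ->
  g^t* *m g = rdiag (fun i : 'I_k => 2 - 2 * c i) ->
  (forall i, 0 <= c i <= 1) ->
  (forall i, 0 <= s i) -> (forall i l, (i <= l)%N -> s l <= s i) -> s k = 0 ->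
  (forall i, (i < k)%N -> 1 - c i = 2 * s i ^+ 2) ->
  U1^t* *m U1 = 1%:M -> U2^t* *m U2 = 1%:M ->
  ip U2 (g^t* *m H *m f *m U1) <=
    \sum_(i < j) 2 * ((L i - L (p - i.+1)%N) * s i).
Proof.
move=> hH hL fg ff gg c01 s0 smono sk cs hU1 hU2.
have gf := adjmx_eq0 fg.
have jk : (j <= k)%N by apply: (gram_size (M := U1)); rewrite hU1 unitmx1.
pose Spr i : R := L i - L (p - i.+1)%N.
pose delta l := s l - s l.+1.
(* The telescoping sum has no boundary term because [s k = 0]. *)
have sE i : (i <= k)%N -> s i = \sum_(i <= l < k) delta l.
  move=> ik; have := telescope_sumr s ik.
  rewrite sk sub0r => /(congr1 -%R); rewrite opprK -sumrN => <-.
  by apply: eq_bigr => l _; rewrite opprB.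
have d0 l : 0 <= delta l by rewrite subr_ge0 smono.
pose E l : 'M[C]_k := rdiag (fun i : 'I_k => (i <= l)%N%:R).
(* The inverse of 0 is 0, so columns with [s i = 0] become zero and [G] is a partial isometry. *)
pose G := g *m rdiag (fun i : 'I_k => (2 * s i)^-1).
pose h := (2^-1 : R)%:C *: f.
have GG : G^t* *m G = rdiag (fun i : 'I_k => (s i != 0)%:R).
  rewrite adjmxM adjmx_rdiag -mulmxA [g^t* *m _]mulmxA gg !mul_rdiag.
  apply: eq_rdiag => i; have -> : 2 - 2 * c i = 4 * s i ^+ 2.
    by have := cs i (ltn_ord i); lra.
  by case: eqVneq => [->|si] /=; [rewrite expr0n /= !mulr0 mul0r mulr0 | field].
(* Where [s i = 0] the column of [g] has norm zero; the equality holds because the difference of the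
   two sides has zero Frobenius norm. *)
have gE : g = G *m rdiag (fun i : 'I_k => 2 * s i).
  rewrite -mulmxA mul_rdiag.
  apply/eqP; rewrite -subr_eq0 -[X in X - _]mulmx1 -mulmxBr -rdiag1 rdiagN rdiagD.
  apply/eqP/ip_eq0; rewrite ipMl [g^t* *m _]mulmxA gg mul_rdiag.
  rewrite -[rdiag _ in X in ip X]mulmx1 ipMl adjmx_rdiag mul_rdiag /ip adjmx1 mul1mx.
  rewrite mxtrace_diag cRe_sum big1 // => i _; rewrite !mxE /=.
  have -> : 2 - 2 * c i = 4 * s i ^+ 2 by have := cs i (ltn_ord i); lra.
  by case: (eqVneq (s i) 0) => [->|si]; [rewrite expr0n /= !mulr0 mul0r mulr0 | field].
have E1 l : bounded 1 (E l).
  apply: (bounded_gram (e := fun i : 'I_k => (i <= l)%N%:R)).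
    rewrite adjmx_rdiag mul_rdiag; apply: eq_rdiag => i.
    by case: leqP => _; rewrite ?mulr1 ?mulr0.
  by move=> i; case: leqP; rewrite ?lexx ?ler01.
have E2 l : E l *m E l = E l.
  by rewrite mul_rdiag; apply: eq_rdiag => i; case: leqP; rewrite ?mulr1 ?mulr0.
have EE l : (l < k)%N -> ip (E l) (E l) = l.+1%:R.
  move=> lk; rewrite -{1}[E l]mulmx1 ipMl adjmx_rdiag E2 /ip adjmx1 mul1mx.
  rewrite mxtrace_diag cRe_sum -[RHS]mulr1 -(sum_lt_const _ lk) [RHS]big_mkcond.
  by apply: eq_bigr => i _; rewrite !mxE ltnS; case: leqP.
have G1 : bounded 1 G.
  by apply: (bounded_gram GG) => i; case: (_ != _); rewrite ?lexx ?ler01.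
have h1 : bounded 1 h.
  apply: (bounded_gram (e := fun i : 'I_k => (1 + c i) / 2)).
    rewrite adjmxZ -scalemxAl -scalemxAr ff; apply/matrixP => a b; rewrite !mxE.
    case: eqVneq => [->|_]; rewrite ?mulr0n ?mulr0 // !mulr1n -!rmorphM /=.
    by congr (_%:C); field.
  by move=> i; have /andP[_] := c01 i; lra.
have hG : h^t* *m G = 0.
  by rewrite adjmxZ -scalemxAl [f^t* *m _]mulmxA fg mul0mx scaler0.
have U1b := bounded_isometry hU1; have U2b := bounded_isometry hU2.
have U2b' := bounded_adj ltr01 U2b.
have ip1 : ip (1%:M : 'M[C]_j) 1%:M = j%:R.
  by rewrite /ip adjmx1 mulmx1 mxtrace1; rewrite -(@rmorph_nat _ _ (real_complex R)).
have ipU (U : 'M[C]_(k, j)) : U^t* *m U = 1%:M -> ip U U = j%:R.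
  by move=> UU; rewrite -{1}[U]mulmx1 ipMl UU.
have Eadj l : (E l)^t* = E l by exact: adjmx_rdiag.
have fE : f = (2 : R)%:C *: h.
  rewrite scalerA -rmorphM /= divff ?pnatr_eq0 //.
  by rewrite -[1%:C]/(1 : C) scale1r.
have sumE : rdiag (fun i : 'I_k => 2 * s i) = \sum_(l < k) (2 * delta l)%:C *: E l.
  apply/matrixP => a b; rewrite summxE !mxE.
  under eq_bigr do rewrite !mxE.
  case: (eqVneq a b) => [_|_]; last by rewrite big1 // => l _; rewrite mulr0n mulr0.
  rewrite mulr1n sE ?(ltnW (ltn_ord a)) // big_geq_mkord mulr_sumr rmorph_sum /=.
  rewrite big_mkcond /=; apply: eq_bigr => l _; rewrite mulr1n -rmorphM /=.
  by case: leqP; rewrite ?mulr1 ?mulr0.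
clearbody E G h.
have size_bound := half_angle_support fg ff gg c01 s0 smono cs.
have term l : (l < k)%N -> s l != 0 ->
    2 * ip (G *m E l *m U2) (H *m (h *m U1)) <=
      \sum_(i < minn l.+1 j) Spr i.
  move=> lk sl; have pl := size_bound l lk sl.
  have hG' q r (M : 'M[C]_(k, q)) (N : 'M[C]_(k, r)) :
      (h *m M)^t* *m (G *m N) = 0.
    by rewrite adjmxM mulmxA -[_ *m _ *m G]mulmxA hG mulmx0 mul0mx.
  (* If [l < j], idempotence lets a copy of [E l] move to the other factor, and both squared norms
     are at most [l.+1]. Otherwise the isometries [U1] and [U2] bound them by [j]. *)
  have [lj|lj] := leqP l.+1 j.
    have -> : ip (G *m E l *m U2) (H *m (h *m U1)) =
        ip (G *m E l) (H *m (h *m (U1 *m U2^t* *m E l))).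
      by rewrite ipMrl -{1}(E2 l) mulmxA ipMrl Eadj !mulmxA.
    have ha := boundedM h1 (boundedM (boundedM U1b U2b') (E1 l)).
    have hb := boundedM G1 (E1 l).
    apply: (spread_bound hH hL (hG' _ _ _ _) ha hb _ _ pl).
      have := bounded1 (E l) (boundedM h1 (boundedM U1b U2b')).
      by rewrite -(mulmxA h) (EE l lk).
    by have := bounded1 (E l) G1; rewrite (EE l lk).
  have ha := boundedM h1 U1b; have hb := boundedM G1 (boundedM (E1 l) U2b).
  rewrite -(mulmxA G); apply: (spread_bound hH hL (hG' _ _ _ _) ha hb).
  - by have := bounded1 U1 h1; rewrite (ipU U1 hU1).
  - have := bounded1 U2 (boundedM G1 (E1 l)).
    by rewrite -(mulmxA G) (ipU U2 hU2).
  - by lia.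
have -> : ip U2 (g^t* *m H *m f *m U1) =
    \sum_(l < k) 2 * delta l * (2 * ip (G *m E l *m U2) (H *m (h *m U1))).
  rewrite -!mulmxA -ipMl gE sumE mulmx_sumr mulmx_suml ip_suml.
  apply: eq_bigr => l _; rewrite -scalemxAr -scalemxAl ipZl; congr (_ * _).
  by rewrite fE -scalemxAl -scalemxAr ipZr.
apply: (@le_trans _ _ (\sum_(l < k) 2 * delta l * \sum_(i < minn l.+1 j) Spr i)).
  apply: ler_sum => l _.
  (* The bound on a term requires [s l != 0]; otherwise its coefficient [delta l] vanishes. *)
  have [sl|sl] := eqVneq (s l) 0.
    suff -> : delta l = 0 by rewrite mulr0 !mul0r.
    by apply/eqP; rewrite eq_le d0 andbT /delta sl sub0r oppr_le0.
  by rewrite ler_wpM2l ?mulr_ge0 // term.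
under eq_bigr => l _.
  rewrite (big_ord_widen j Spr (geq_minr _ _)) big_mkcond mulr_sumr.
  over.
rewrite exchange_big /=; apply: ler_sum => i _.
have ik : (i <= k)%N by have := ltn_ord i; lia.
rewrite sE // big_geq_mkord mulrCA !mulr_sumr [leRHS]big_mkcond /=.
apply: ler_sum => l _; rewrite leq_min ltn_ord andbT ltnS.
case: leqP => _; last by rewrite mulr0.
by rewrite -/(Spr i) le_eqVlt; apply/orP; left; apply/eqP; ring.
Qed.

End Spread.

(** * Compression to a subspace *)

Section Compression.
Variable R : realType.
Local Notation C := R[i].

(** The function underlying [compression], named so that it can carry a linear structure and [lfunE]
    applies. *)
Definition compression_fun d (A : 'M[C]_d) (Z : {vspace 'cV[C]_d})
  (u : subvs_of Z) : subvs_of Z := vsproj Z (orthoproj Z *m (A *m vsval u)).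

Lemma compression_fun_linear d (A : 'M[C]_d) (Z : {vspace 'cV[C]_d}) :
  linear (compression_fun A (Z := Z)).
Proof.
move=> x u v; rewrite /compression_fun linearP /= !mulmxDr.
by rewrite -!scalemxAr linearP.
Qed.

HB.instance Definition _ d (A : 'M[C]_d) (Z : {vspace 'cV[C]_d}) :=
  GRing.isSemilinear.Build C _ _ _ (compression_fun A (Z := Z))
    (GRing.semilinear_linear (compression_fun_linear A (Z := Z))).

Lemma compressionE d (A : 'M[C]_d) (Z : {vspace 'cV[C]_d}) :
  compression A Z =1 compression_fun A (Z := Z).
Proof.
move=> u; rewrite /compression -[fun u => vsproj _ _]/(compression_fun A (Z := Z)).
exact: lfunE.
Qed.

Definition basis_rows d (Z : {vspace 'cV[C]_d}) : 'M[C]_(\dim Z, d) :=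
  \matrix_i (tnth (vbasis Z) i)^T.

Lemma basis_rowsP d (Z : {vspace 'cV[C]_d}) (v : 'cV[C]_d) :
  (v \in Z) = (v^T <= basis_rows Z)%MS.
Proof.
apply/idP/submxP => [vZ|[D vE]].
  exists (\row_i coord (vbasis Z) i v).
  rewrite {1}(coord_vbasis vZ) linear_sum mulmx_sum_row.
  by apply: eq_bigr => i _; rewrite linearZ rowK mxE (tnth_nth 0).
rewrite -[v]trmxK vE mulmx_sum_row linear_sum memv_suml // => i _.
by rewrite linearZ /= memvZ // rowK /= trmxK vbasis_mem // mem_tnth.
Qed.

Lemma orthoproj_mem d (Z : {vspace 'cV[C]_d}) (v : 'cV[C]_d) :
  orthoproj Z *m v \in Z.
Proof. by rewrite basis_rowsP trmx_mul trmxK proj_ortho_sub. Qed.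

(** The adjoint form of the fact that the projection fixes the columns of [Q]: the rows of
    [1 - proj_ortho] are orthogonal to the row space. *)
Lemma adj_orthoproj d n (Z : {vspace 'cV[C]_d}) (Q : 'M[C]_(d, n)) :
  (forall i, col i Q \in Z) -> Q^t* *m orthoproj Z = Q^t*.
Proof.
move=> QZ.
have /submxP [D QE] : (Q^T <= basis_rows Z)%MS.
  by apply/row_subP => i; rewrite -tr_col -basis_rowsP.
have := proj_ortho_compl_sub (basis_rows Z) 1%:M; rewrite mul1mx.
move=> /orthomx1P; rewrite mulmxBl mul1mx => /eqP; rewrite subr_eq0 => /eqP h.
have h' : map_mx Num.conj (basis_rows Z) *m orthoproj Z =
    map_mx Num.conj (basis_rows Z).
  apply: trmx_inj; rewrite trmx_mul trmxK map_trmx; exact: esym.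
by rewrite QE map_mxM -mulmxA h'.
Qed.

Lemma char_poly_tr (F : comNzRingType) n (M : 'M[F]_n) :
  char_poly M^T = char_poly M.
Proof.
rewrite /char_poly -[RHS]det_tr; congr (\det _).
by rewrite /char_poly_mx linearB /= tr_scalar_mx map_trmx.
Qed.

(** The columns of [Q] form an orthonormal basis of [Z], and the change of basis from [vbasis] makes
    the matrix of the compression similar to [Q^* A Q]. The problem thus moves to matrices of size
    [\dim {: subvs_of Z}]. *)
Lemma compression_eigvals d (A : 'M[C]_d) (Z : {vspace 'cV[C]_d}) :
  exists Q : 'M[C]_(d, \dim {: subvs_of Z}),
  [/\ Q^t* *m Q = 1%:M, forall v, v \in Z -> v = Q *m (Q^t* *m v) &
      lfun_eigvals (compression A Z) = eigvals (Q^t* *m A *m Q)].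
Proof.
set n := \dim {: subvs_of Z}.
pose e := vbasis (fullv : {vspace subvs_of Z}).
have e_basis : basis_of {: subvs_of Z} e by exact: vbasisP.
pose B : 'M[C]_(d, n) := \matrix_(a, i) vsval (tnth e i) a 0.
have BE (y : 'rV[C]_n) : B *m y^T = vsval (passmx.vecof e y).
  rewrite /passmx.vecof linear_sum.
  apply/colP => a; rewrite !mxE summxE; apply: eq_bigr => i _.
  by rewrite linearZ /= !mxE mulrC (tnth_nth 0).
have Bfree : row_free B^T.
  apply: inj_row_free => y yB.
  have : vsval (passmx.vecof e y) = 0.
    by rewrite -BE -[B]trmxK -trmx_mul yB trmx0.
  rewrite -[0](linear0 (@vsval _ _ Z)) => /val_inj.
  move=> /(congr1 (passmx.rVof e)); rewrite passmx.vecofK // => ->.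
  by apply/eqP; rewrite passmx.rVof_eq0.
have nd : (n <= d)%N by rewrite -(eqP Bfree) rank_leq_col.
(* Gram-Schmidt works on rows, hence the transposes; [T] below is the transition matrix from the
   columns of [B] to those of [Q]. *)
pose S := schmidt B^T.
have /unitarymxP SS := schmidt_unitarymx B^T nd.
have SB : (S :=: B^T)%MS by exact: eqmx_schmidt_free.
pose Q := S^T.
have QQ : Q^t* *m Q = 1%:M.
  by apply: trmx_inj; rewrite /Q trmx_mul trmx1 -SS !trmxK map_trmx.
pose T := (S *m pinvmx B^T)^T.
have QE : Q = B *m T.
  by apply: trmx_inj; rewrite /Q /T trmx_mul !trmxK mulmxKpV // SB.
have Tunit : T \in unitmx.
  rewrite -row_full_unit -sub1mx -QQ QE mulmxA; exact: submxMl.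
pose M := passmx.mxof e e (compression A Z).
(* [M] acts on row vectors, so its transpose is the matrix of the compression in the columns of
   [B]. *)
have BM : B *m M^T = orthoproj Z *m A *m B.
  apply/trmx_inj/row_matrixP => i; rewrite !rowE; apply: trmx_inj.
  set u := delta_mx 0 i.
  rewrite !trmx_mul !trmxK -!mulmxA -trmx_mul !BE.
  rewrite passmx.mul_mxof passmx.rVofK // compressionE vsprojK //.
  exact: orthoproj_mem.
have BQ : B = Q *m invmx T by rewrite QE mulmxK.
have QP : Q^t* *m orthoproj Z = Q^t*.
  apply: adj_orthoproj => i; rewrite QE colE -mulmxA -[T *m _]trmxK BE.
  exact: subvsP.
have AQ : Q^t* *m A *m Q = invmx T *m M^T *m T.
  transitivity (Q^t* *m (orthoproj Z *m A *m B) *m T).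
    by rewrite !mulmxA QP -(mulmxA _ B T) -QE.
  by rewrite -BM {1}BQ !mulmxA QQ mul1mx.
exists Q; split=> [//|v vZ|].
- have [y ->] : exists y, v = Q *m y.
    exists (invmx T *m (passmx.rVof e (vsproj Z v))^T).
    by rewrite QE mulmxA mulmxK // BE passmx.rVofK // vsprojK.
  by rewrite [Q^t* *m _]mulmxA QQ mul1mx.
- have cp : char_poly M = char_poly (Q^t* *m A *m Q).
    rewrite AQ -[LHS]char_poly_tr; apply: esym.
    exact: char_poly_similar (mulVmx Tunit).
  exact: (eigvals_char_poly cp).
Qed.

End Compression.

(** * Principal angles *)

Section Angles.
Variable R : realType.
Local Notation C := R[i].

(** The doubled form avoids dividing by 2 in the ring. *)
Lemma polarization (F : comNzRingType) p k (H : 'M[F]_p) (a b : 'M[F]_(k, p))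
    (x y : 'M[F]_(p, k)) :
  (a - b) *m H *m (x + y) + (a + b) *m H *m (x - y) =
    (a *m H *m x - b *m H *m y) + (a *m H *m x - b *m H *m y).
Proof.
rewrite !mulmxDl !mulmxDr !mulmxN !mulNmx.
move: (a *m H *m x) (a *m H *m y) (b *m H *m x) (b *m H *m y) => u v w z.
by apply/matrixP => i j; rewrite !mxE; ring.
Qed.

(** By polarization, twice the left side is a sum of two traces; taking adjoints gives the second
    the shape of the first with [U1] and [U2] exchanged, so one bound serves both. The dimension
    count is returned as well, for the sign of the spread entries. *)
Lemma compressions_sub_le p k j (H : 'M[C]_p) (L : nat -> R)
    (x y : 'M[C]_(p, k)) (c s : nat -> R) (U1 U2 : 'M[C]_(k, j)) :
  H^t* = H -> spectrum H (fun i => L i) ->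
  x^t* *m x = 1%:M -> y^t* *m y = 1%:M ->
  x^t* *m y = rdiag (fun i : 'I_k => c i) ->
  (forall i, 0 <= c i <= 1) ->
  (forall i, 0 <= s i) -> (forall i l, (i <= l)%N -> s l <= s i) -> s k = 0 ->
  (forall i, (i < k)%N -> 1 - c i = 2 * s i ^+ 2) ->
  U1^t* *m U1 = 1%:M -> U2^t* *m U2 = 1%:M ->
  ip U2 ((x^t* *m H *m x - y^t* *m H *m y) *m U1) <=
    \sum_(i < j) 2 * ((L i - L (p - i.+1)%N) * s i) /\
  (forall l, (l < k)%N -> s l != 0 -> (l.+1.*2 <= p)%N).
Proof.
move=> hH hL xx yy xy c01 s0 smono sk cs hU1 hU2.
have yx : y^t* *m x = rdiag (fun i : 'I_k => c i).
  by rewrite -[LHS]trmxCK adjmxM trmxCK xy adjmx_rdiag.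
pose f := x + y; pose g := x - y.
have fg : f^t* *m g = 0.
  by rewrite adjmxD mulmxDl !mulmxBr xx xy yx yy addrC subrKA subrr.
have ff : f^t* *m f = rdiag (fun i : 'I_k => 2 + 2 * c i).
  rewrite adjmxD mulmxDl !mulmxDr xx xy yx yy -rdiag1 !rdiagD.
  by apply: eq_rdiag => i; ring.
have gg : g^t* *m g = rdiag (fun i : 'I_k => 2 - 2 * c i).
  rewrite adjmxD adjmxN mulmxDl !mulNmx !mulmxBr xx xy yx yy -rdiag1.
  rewrite !rdiagN !rdiagD rdiagN rdiagD.
  by apply: eq_rdiag => i; ring.
split; last exact: half_angle_support fg ff gg c01 s0 smono cs.
have bound V1 V2 : V1^t* *m V1 = 1%:M -> V2^t* *m V2 = 1%:M -> _ :=
  half_angle_bound hH hL fg ff gg c01 s0 smono sk cs.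
have E : 2 * ip U2 ((x^t* *m H *m x - y^t* *m H *m y) *m U1) =
    ip U2 (g^t* *m H *m f *m U1) + ip U1 (g^t* *m H *m f *m U2).
  have -> : ip U1 (g^t* *m H *m f *m U2) = ip U2 (f^t* *m H *m g *m U1).
    by rewrite ipMr ipC !adjmxM trmxCK hH mulmxA.
  rewrite -ipDr -mulmxDl.
  have -> : 2 * ip U2 ((x^t* *m H *m x - y^t* *m H *m y) *m U1) =
      ip U2 (((x^t* *m H *m x - y^t* *m H *m y) +
              (x^t* *m H *m x - y^t* *m H *m y)) *m U1).
    by move: (_ - _) => D; rewrite mulmxDl ipDr mulr_natl mulr2n.
  have fE : f^t* = x^t* + y^t* by exact: adjmxD.
  have gE : g^t* = x^t* - y^t* by rewrite adjmxD adjmxN.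
  by rewrite fE gE polarization.
have h1 := bound _ _ _ hU1 hU2; have h2 := bound _ _ _ hU2 hU1.
have := lerD h1 h2; rewrite -E.
by move: (ip _ _) (\sum_(i < j) _) => u v; clear; lra.
Qed.

(** Each [l i] is the squared norm of [N *m v] for a unit eigenvector [v]. *)
Lemma gram_spectrum_ge0_le1 p k (N : 'M[C]_(p, k)) (l : 'I_k -> R) :
  bounded 1 N -> spectrum (N^t* *m N) l -> forall i, 0 <= l i <= 1.
Proof.
move=> bN [_ [V [VV VV' NE]]] i; pose v : 'cV[C]_k := V *m delta_mx i 0.
have vv : ip v v = 1 by rewrite ipMl mulmxA VV mul1mx ip_delta.
suff -> : l i = ip (N *m v) (N *m v) by rewrite ip_ge0 -vv bounded1.
rewrite ipMl mulmxA NE ip_spectral mulmxA VV mul1mx.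
rewrite -ip_rdiag.
have -> : rdiag l *m (delta_mx i 0 : 'cV_k) = (l i)%:C *: delta_mx i 0.
  apply/matrixP => a b; rewrite /rdiag mul_diag_mx !mxE.
  by case: eqVneq => [->|_] //=; rewrite !mulr0.
by rewrite ipZr ip_delta mulr1.
Qed.

(** The eigenvectors are reversed because non-increasing angles have non-decreasing cosines. As
    every [l i] is positive, the left factor is [N *m V] with normalized columns. *)
Lemma singular_values_decomposition k (N : 'M[C]_k) (l : 'I_k -> R) :
  spectrum (N^t* *m N) l -> (forall i, 0 < l i) ->
  exists U V : 'M[C]_k, [/\ U^t* *m U = 1%:M, V^t* *m V = 1%:M &
    U^t* *m N *m V = rdiag (fun i => Num.sqrt (l (rev_ord i)))].
Proof.
move=> [_ [W [WW WW' NE]]] l0.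
pose V := colsub (@rev_ord k) W.
have NV : (N *m V)^t* *m (N *m V) = rdiag (fun i => l (rev_ord i)).
  have : (N *m W)^t* *m (N *m W) = rdiag l.
    rewrite adjmxM !mulmxA -(mulmxA (W^t*)) NE !mulmxA WW mul1mx -mulmxA WW.
    by rewrite mulmx1.
  rewrite mulmx_colsub; move: (N *m W) => Z ZZ; apply/matrixP => a b.
  have /matrixP/(_ (rev_ord a) (rev_ord b)) := ZZ.
  rewrite !mxE (inj_eq rev_ord_inj) => <-.
  by apply: eq_bigr => i _; rewrite !mxE.
have VV : V^t* *m V = 1%:M.
  apply/matrixP => a b; have /matrixP/(_ (rev_ord a) (rev_ord b)) := WW.
  rewrite !mxE (inj_eq rev_ord_inj) => <-; apply: eq_bigr => i _.
  by rewrite !mxE.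
pose r (i : 'I_k) : R := Num.sqrt (l (rev_ord i)).
have r0 i : r i != 0 by rewrite gt_eqF // sqrtr_gt0.
pose U := N *m V *m rdiag (fun i => (r i)^-1).
have rr i : l (rev_ord i) = r i * r i by rewrite -expr2 sqr_sqrtr ?ltW.
exists U, V; split; [|exact: VV|].
- rewrite adjmxM adjmx_rdiag -mulmxA [_^t* *m (_ *m _)]mulmxA NV !mul_rdiag -rdiag1.
  apply: eq_rdiag => i; rewrite rr. by field; exact: r0.
- rewrite -mulmxA adjmxM adjmx_rdiag -mulmxA NV mul_rdiag.
  apply: eq_rdiag => i; rewrite -[RHS]/(r i) rr. by field; exact: r0.
Qed.

End Angles.

(** * Half angles and the final estimate *)

(** With [c = cos t] the left side is [sin (t / 2)]. After multiplying by [c] and squaring, the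
    difference factors as [(1 - c) (1 + c (1 - c / 2))]. *)
Lemma half_angle_sin_le_tan (R : realType) (c : R) : 0 < c <= 1 ->
  Num.sqrt ((1 - c) / 2) <= sin (acos c) / cos (acos c).
Proof.
move=> /andP[c0 c1].
have cI : -1 <= c <= 1 by rewrite c1 andbT; lra.
rewrite sin_acos // acosK ?in_itv //= ler_pdivlMr //.
have -> : Num.sqrt ((1 - c) / 2) * c = Num.sqrt ((1 - c) / 2 * c ^+ 2).
  rewrite [RHS]sqrtrM; last by rewrite divr_ge0 ?subr_ge0.
  by rewrite sqrtr_sqr gtr0_norm.
rewrite ler_wsqrtr // -subr_ge0.
have -> : 1 - c ^+ 2 - (1 - c) / 2 * c ^+ 2 = (1 - c) * (1 + c * (1 - c / 2)).
  by field.
by rewrite mulr_ge0 ?subr_ge0 // addr_ge0 // mulr_ge0 ?ltW //; lra.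
Qed.

Lemma orthonormal_basis_gram (R : realType) d k (V : {vspace 'cV[R[i]]_d}) (X : 'M_(d, k)) :
  orthonormal_basis V X -> X^t* *m X = 1%:M.
Proof. by case. Qed.

Lemma orthonormal_basis_col (R : realType) d k (V : {vspace 'cV[R[i]]_d}) (X : 'M_(d, k)) :
  orthonormal_basis V X -> forall i, col i X \in V.
Proof.
by case=> _ hb i; apply: (basis_mem hb); apply: map_f; rewrite mem_enum.
Qed.

Lemma principal_anglesE (R : realType) d k (X Y : 'M[R[i]]_(d, k)) i :
  tnth (principal_angles X Y) i = acos (Num.sqrt
    (tnth (eigvals ((X^t* *m Y)^t* *m (X^t* *m Y))) (rev_ord i))).
Proof. by rewrite /principal_angles tnth_mktuple /singvals tnth_mktuple. Qed.

Lemma half_angle_sequences (R : realType) k (l : 'I_k -> R) :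
  (forall i j : 'I_k, (i <= j)%N -> l j <= l i) -> (forall i, 0 < l i <= 1) ->
  exists c s : nat -> R,
  [/\ (forall i : 'I_k, c i = Num.sqrt (l (rev_ord i))) /\
        (forall i, 0 < c i <= 1),
      forall i, s i = Num.sqrt ((1 - c i) / 2),
      forall i j, (i <= j)%N -> s j <= s i,
      s k = 0 & forall i, 1 - c i = 2 * s i ^+ 2].
Proof.
move=> ldec l01.
(* Beyond [k] the cosine is 1, that is, the angle is 0: the half-angle sines stay non-increasing on
   all naturals and vanish at [k]. *)
pose c i : R :=
  oapp (fun i' : 'I_k => Num.sqrt (l (rev_ord i'))) 1 (insub i).
have cE (i : 'I_k) : c i = Num.sqrt (l (rev_ord i)) by rewrite /c valK.
have c_big i : (k <= i)%N -> c i = 1 by move=> ki; rewrite /c insubN // -leqNgt.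
clearbody c.
have c01 a : 0 < c a <= 1.
  have [ak|ka] := ltnP a k; last by rewrite c_big // ltr01 lexx.
  rewrite -[a]/(val (Ordinal ak)) cE sqrtr_gt0 -[X in _ <= X]sqrtr1.
  by have /andP[-> l1] := l01 (rev_ord (Ordinal ak)); rewrite ler_wsqrtr.
exists c, (fun a => Num.sqrt ((1 - c a) / 2)); split=> // [a b ab||a].
- suff : c a <= c b by move=> cab; rewrite ler_wsqrtr //; lra.
  have [bk|kb] := ltnP b k; last by rewrite (c_big b) //; case/andP: (c01 a).
  have ak : (a < k)%N by lia.
  rewrite -[a]/(val (Ordinal ak)) -[b]/(val (Ordinal bk)) !cE.
  by rewrite ler_wsqrtr // ldec //=; lia.
- by rewrite c_big // subrr mul0r sqrtr0.
- rewrite sqr_sqrtr; first by field.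
  by have /andP[_] := c01 a; lra.
Qed.

Lemma spectral_spreadE (R : realType) d (A : 'M[R[i]]_d)
    (Z : {vspace 'cV[R[i]]_d}) (a : nat) : (a < \dim Z)%N ->
  (spectral_spread A Z)`_a =
    (lfun_eigvals (compression A Z))`_a -
    (lfun_eigvals (compression A Z))`_(\dim Z - a.+1)%N.
Proof. by move=> aZ; rewrite /spectral_spread (nth_mktuple _ 0 (Ordinal aZ)). Qed.

Lemma mul_proj_cols (F : pzRingType) d p k (Q : 'M[F]_(d, p)) (P : 'M[F]_(p, d))
    (X : 'M[F]_(d, k)) :
  (forall i, col i X = Q *m (P *m col i X)) -> X = Q *m (P *m X).
Proof.
move=> h; apply/matrixP => a b.
have /colP/(_ a) : col b X = col b (Q *m (P *m X)) by rewrite [RHS]colE -!mulmxA -colE -h.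
by move: (Q *m _) => Y; rewrite !mxE.
Qed.

Theorem theorem3p11 (R : realType) (d k : nat) (A : 'M[R[i]]_d)
    (XX YY : {vspace 'cV[R[i]]_d}) (X Y : 'M[R[i]]_(d, k))
    (hA : A \is hermsymmx) (hk : (0 < k)%N)
    (hXX : \dim XX = k) (hYY : \dim YY = k)
    (hX : orthonormal_basis XX X) (hY : orthonormal_basis YY Y)
    (hTheta : tnth (principal_angles X Y) (Ordinal hk) < pi / 2) :
  let Theta := principal_angles X Y in
  let lamX := eigvals (X^t* *m A *m X) in
  let lamY := eigvals (Y^t* *m A *m Y) in
  let Spr := spectral_spread A (XX + YY) in
  submajorized
    [tuple `|tnth lamX i - tnth lamY i| | i < k]
    [tuple 2 * (Spr`_i * sin (tnth Theta i)) / cos (tnth Theta i) | i < k].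
Proof.
move=> Theta lamX lamY Spr j /andP[_ jk].
have AA : A^t* = A.
  by have := is_hermitianmxP _ _ _ hA; rewrite expr0 scale1r => <-.
pose Z := (XX + YY)%VS.
have [Q [QQ QZ LE]] := compression_eigvals A Z.
set p := \dim {: subvs_of Z} in Q QQ QZ LE.
have pZ : p = \dim Z by rewrite /p dimvf.
pose H := Q^t* *m A *m Q.
have hH : H^t* = H by rewrite !adjmxM trmxCK AA mulmxA.
pose L i := (lfun_eigvals (compression A Z))`_i.
have hL : spectrum H (fun i => L i).
  apply: eq_spectrum (hermitian_spectrum hH) => i.
  by rewrite /L LE (tnth_nth 0).
(* Coordinates in the orthonormal basis [Q] of the sum of the two subspaces, which preserve Gram
   matrices and compressions. *)
pose x := Q^t* *m X; pose y := Q^t* *m Y.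
have XE : X = Q *m x.
  apply: mul_proj_cols => i; apply: QZ.
  by apply: subvP (orthonormal_basis_col hX i); apply: addvSl.
have YE : Y = Q *m y.
  apply: mul_proj_cols => i; apply: QZ.
  by apply: subvP (orthonormal_basis_col hY i); apply: addvSr.
clearbody x y.
have gramE (u v : 'M[R[i]]_(p, k)) : (Q *m u)^t* *m (Q *m v) = u^t* *m v.
  by rewrite adjmxM -mulmxA (mulmxA (Q^t*)) QQ mul1mx.
have formE (u : 'M[R[i]]_(p, k)) :
    (Q *m u)^t* *m A *m (Q *m u) = u^t* *m H *m u.
  by rewrite adjmxM /H !mulmxA.
clearbody H.
have xx : x^t* *m x = 1%:M by rewrite -gramE -XE (orthonormal_basis_gram hX).
have yy : y^t* *m y = 1%:M by rewrite -gramE -YE (orthonormal_basis_gram hY).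
have kp : (k <= p)%N by apply: (gram_size (M := x)); rewrite xx unitmx1.
pose N := x^t* *m y.
have NE : X^t* *m Y = N by rewrite XE YE gramE.
have [l ThetaE hl] : exists2 l : 'I_k -> R,
    forall i, tnth Theta i = acos (Num.sqrt (l (rev_ord i))) &
    spectrum (N^t* *m N) l.
  exists (tnth (eigvals (N^t* *m N))).
    by move=> i; rewrite -NE /Theta principal_anglesE.
  by apply: hermitian_spectrum; rewrite adjmxM trmxCK.
have l01 : forall i, 0 <= l i <= 1.
  apply: gram_spectrum_ge0_le1 hl; apply: boundedM.
    by apply: bounded_adj (bounded_isometry xx).
  exact: bounded_isometry.
have ldec := hl.1.
have lgt01 i : 0 < l i <= 1.
  have /andP[_ ->] := l01 i; rewrite andbT.
  (* The last index carries the smallest eigenvalue, the squared cosine of the largest angle; were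
     it 0, that angle would be [pi / 2]. *)
  pose i0 : 'I_k := rev_ord (Ordinal hk).
  apply: (@lt_le_trans _ _ (l i0)); last first.
    by apply: ldec => /=; have := ltn_ord i; lia.
  have /andP[l0 _] := l01 i0; rewrite lt_neqAle l0 andbT eq_sym.
  apply/eqP => l00; move: hTheta.
  by rewrite -/Theta ThetaE -/i0 l00 sqrtr0 acos0 ltxx.
clear hTheta; have l_gt0 i : 0 < l i by case/andP: (lgt01 i).
have [U [V [UU VV UNV]]] := singular_values_decomposition hl l_gt0.
have [c [s [[cE c01'] sE smono sk cs]]] := half_angle_sequences ldec lgt01.
have c01 i : 0 <= c i <= 1 by have /andP[/ltW-> ->] := c01' i.
have s0 i : 0 <= s i by rewrite sE sqrtr_ge0.
(* Principal vectors: their cross Gram matrix is the diagonal of cosines, while the eigenvalues of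
   both compressions are unchanged. *)
pose x' := x *m U; pose y' := y *m V.
have gramM (u v : 'M[R[i]]_(p, k)) (W W' : 'M[R[i]]_k) :
    (u *m W)^t* *m (v *m W') = W^t* *m (u^t* *m v) *m W'.
  by rewrite adjmxM !mulmxA.
have xx' : x'^t* *m x' = 1%:M by rewrite gramM xx mulmx1.
have yy' : y'^t* *m y' = 1%:M by rewrite gramM yy mulmx1.
have xy' : x'^t* *m y' = rdiag (fun i : 'I_k => c i).
  by rewrite gramM -/N UNV; apply: eq_rdiag => i; rewrite cE.
have spec (u : 'M[R[i]]_(p, k)) (W : 'M[R[i]]_k) : W^t* *m W = 1%:M ->
    spectrum ((u *m W)^t* *m H *m (u *m W)) (tnth (eigvals (u^t* *m H *m u))).
  move=> WW.
  have -> : (u *m W)^t* *m H *m (u *m W) = W^t* *m (u^t* *m H *m u) *m W.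
    by rewrite adjmxM !mulmxA.
  rewrite -(eigvals_unitary _ WW); apply: hermitian_spectrum.
  by rewrite !adjmxM !trmxCK hH !mulmxA.
have hermM (u : 'M[R[i]]_(p, k)) : (u^t* *m H *m u)^t* = u^t* *m H *m u.
  by rewrite !adjmxM trmxCK hH mulmxA.
have [J cJ ->] := sort_sum_eq (fun i => `|tnth lamX i - tnth lamY i|) jk.
have [U1 [U2 [hU1 hU2 lid]]] :=
  lidskii_mirsky (hermM x') (hermM y') (spec x U UU) (spec y V VV) cJ.
rewrite /lamX /lamY XE YE !formE.
apply: le_trans lid _.
have [bound support] :=
  compressions_sub_le hH hL xx' yy' xy' c01 s0 smono sk (fun i _ => cs i) hU1 hU2.
apply: le_trans bound _.
(* The right side may be unsorted, but its [j] largest entries sum to at least its first [j]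
   entries. *)
apply: le_trans (sort_sum_ge _ jk).
rewrite (big_ord_widen k (fun i => 2 * ((L i - L (p - i.+1)%N) * s i)) jk).
apply: ler_sum => i _; rewrite ThetaE -cE.
have i_p : (i < p)%N by apply: leq_trans (ltn_ord i) kp.
have -> : Spr`_i = L i - L (p - i.+1)%N.
  by rewrite /Spr spectral_spreadE -pZ.
(* A zero angle makes both terms zero. Otherwise the dimension count puts [i] before its mirror
   index, so the spread entry is nonnegative and may multiply the half-angle inequality. *)
have [si|si] := eqVneq (s i) 0.
  have -> : c i = 1 by have := cs i; rewrite si; lra.
  by rewrite acos1 sin0 si !mulr0 mul0r.
have ip2 := support i (ltn_ord i) si.
have i_p' : (p - i.+1 < p)%N by lia.
have spr0 : 0 <= L i - L (p - i.+1)%N.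
  by rewrite subr_ge0; apply: (hL.1 (Ordinal i_p) (Ordinal i_p')) => /=; lia.
have := half_angle_sin_le_tan (c01' i); rewrite -sE.
move: (L i - _) (s i) (sin _) (cos _) spr0 => D t u v; clear => D0 tuv.
by rewrite -!mulrA; do 2?[apply: ler_wpM2l => //].
Qed.
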